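(* For $n\in\mathbb{N}$ put $E_n(X):=e^{nX}$ and $L_n(X):=\dfrac{e^{X}q^{n}}{1-e^{X}q^{n}}\in\mathbb{Q}[[q,X]]$. For every $l\ge 1$ the generating series of bi-brackets (defined in the context) satisfies \[ T\binom{X_1,\dots,X_l}{Y_1,\dots,Y_l}=\sum_{u_1>\dots>u_l>0}\prod_{j=1}^{l}E_{u_j}(Y_j)\,L_{u_j}(X_j) =\sum_{u_1>\dots>u_l>0}\prod_{j=1}^{l}E_{u_j}(X_{l+1-j}-X_{l+2-j})\,L_{u_j}(Y_1+\dots+Y_{l-j+1}), \] where $X_{l+1}:=0$. In particular the partition relation holds: \[ T\binom{X_1,\dots,X_l}{Y_1,\dots,Y_l}=T\binom{Y_1+\dots+Y_l,\ \dots,\ Y_1+Y_2,\ Y_1}{X_l,\ X_{l-1}-X_l,\ \dots,\ X_1-X_2}. \]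
   Context: For integers $s_1,\dots,s_l\ge1$ and $r_1,\dots,r_l\ge0$ the bi-bracket is the $q$-series \[ \binom{s_1,\dots,s_l}{r_1,\dots,r_l}:=\sum_{\substack{u_1>\dots>u_l>0\\ v_1,\dots,v_l>0}}\prod_{j=1}^{l}\frac{u_j^{r_j}}{r_j!}\,\frac{v_j^{s_j-1}}{(s_j-1)!}\;q^{u_1v_1+\dots+u_lv_l}\in\mathbb{Q}[[q]]. \] Its generating series is \[ T\binom{X_1,\dots,X_l}{Y_1,\dots,Y_l}:=\sum_{\substack{s_1,\dots,s_l>0\\ r_1,\dots,r_l>0}}\binom{s_1,\dots,s_l}{r_1-1,\dots,r_l-1}X_1^{s_1-1}\cdots X_l^{s_l-1}\,Y_1^{r_1-1}\cdots Y_l^{r_l-1}, \] a formal power series in $X_1,\dots,X_l,Y_1,\dots,Y_l$ with coefficients in $\mathbb{Q}[[q]]$. All identities are identities of formal power series in $q$ and the variables. *)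

(* Defs.v *)
From HB Require Import structures.
From mathcomp Require Import all_boot all_order all_algebra.
From mathcomp Require Import mpoly.
From Stdlib Require Import ClassicalEpsilon.

Set Implicit Arguments.
Unset Strict Implicit.
Unset Printing Implicit Defensive.

Import Order.TTheory GRing.Theory Num.Theory.
Local Open Scope ring_scope.

Definition fps (k : nat) := 'X_{1..k} -> rat.

Definition fps_one k : fps k := fun m => if m == mnm0 then 1 else 0.
Definition fps_sub k (f g : fps k) : fps k := fun m => f m - g m.
Definition fps_mono k (m0 : 'X_{1..k}) : fps k :=
  fun m => if m == m0 then 1 else 0.

Definition fps_mul k (f g : fps k) : fps k := fun m =>
  \sum_(p : 'X_{1..k < (mdeg m).+1, (mdeg m).+1} | mnm_add p.1 p.2 == m)
     f p.1 * g p.2.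

(* quotient f / g in the power series ring: the series h with g h = f
   (it exists and is unique whenever g has an invertible constant term) *)
Definition fps_div k (f g : fps k) : fps k :=
  epsilon (inhabits (fun _ => 0)) (fun h => fps_mul g h = f).

Definition hpart k (f : fps k) (d : nat) : {mpoly rat[k]} :=
  \sum_(p : 'X_{1..k < d.+1} | mdeg p == d) f p *: 'X_[p].

(* substitution x_i |-> A i of HOMOGENEOUS LINEAR forms A i (only used
   with such forms): degree is preserved, so the coefficient of m is read
   off the image of the homogeneous component of degree mdeg m. *)
Definition fps_subst k n (A : 'I_k -> {mpoly rat[n]}) (f : fps k) : fps n :=
  fun m => mcoeff m (comp_mpoly [tuple A i | i < k] (hpart f (mdeg m))).

Definition fps_hasSum (I : eqType) k (P : pred I) (G : I -> fps k) (F : fps k)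
  : Prop :=
  forall m, exists s : seq I,
    [/\ uniq s, all P s,
        (forall u, P u -> G u m != 0 -> u \in s)
      & F m = \sum_(u <- s) G u m].

Definition fps_expo (c : rat) : fps 1 :=
  fun m => c ^+ (m ord0) / ((m ord0)`!)%:R.

Definition Eser (n : nat) : fps 1 := fps_expo n%:R.

(* L_n(X) = e^X q^n / (1 - e^X q^n) in Q[[q,X]]; variable 0 is q,
   variable 1 (= ord_max) is X *)
Definition eX2 : fps 2 := fps_subst (fun _ : 'I_1 => 'X_(ord_max : 'I_2)) (fps_expo 1).
Definition eXqn (n : nat) : fps 2 :=
  fps_mul eX2 (fps_mono (mnm_muln (mnm1 (ord0 : 'I_2)) n)).
Definition Lser (n : nat) : fps 2 := fps_div (eXqn n) (fps_sub (@fps_one 2) (eXqn n)).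

Definition pos_dec l (u : 'I_l -> nat) : bool :=
  [forall i : 'I_l, forall j : 'I_l, (i < j)%N ==> (u j < u i)%N]
  && [forall j : 'I_l, (0 < u j)%N].

(* coefficient of q^N in the bi-bracket (s_1..s_l ; r_1..r_l).
   Since all v_j >= 1 and u_j >= 1 with sum u_j v_j = N, all u_j, v_j <= N,
   so the sum may be taken over u, v : 'I_l -> {0..N}. *)
Definition bibracket l (s r : 'I_l -> nat) (N : nat) : rat :=
  \sum_(u : {ffun 'I_l -> 'I_N.+1})
   \sum_(v : {ffun 'I_l -> 'I_N.+1} |
          [&& pos_dec (fun j => nat_of_ord (u j)),
              [forall j, (0 < v j)%N] &
              (\sum_(j < l) u j * v j)%N == N])
     \prod_(j < l) ( ((u j : nat) ^ r j)%:R / ((r j)`!)%:R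
                   * ((v j : nat) ^ (s j - 1))%:R / ((s j - 1)`!)%:R ).

(* variables of Q[[q, X_1..X_l, Y_1..Y_l]], indexed by 'I_(1 + l + l):
   0 is q, then X_1..X_l, then Y_1..Y_l. *)
Definition qv l : 'I_(1 + l + l) := lshift l (lshift l (ord0 : 'I_1)).
Definition xv l (j : 'I_l) : 'I_(1 + l + l) := lshift l (rshift 1 j).
Definition yv l (j : 'I_l) : 'I_(1 + l + l) := rshift (1 + l) j.

Definition Tgen l : fps (1 + l + l) := fun m =>
  bibracket (fun j => (m (xv j)).+1) (fun j => m (yv j)) (m (qv l)).

Definition Esub l (n : nat) (form : {mpoly rat[1 + l + l]}) : fps (1 + l + l) :=
  fps_subst (fun _ : 'I_1 => form) (Eser n).
Definition Lsub l (n : nat) (form : {mpoly rat[1 + l + l]}) : fps (1 + l + l) :=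
  fps_subst (fun i : 'I_2 => if i == ord0 then 'X_(qv l) else form) (Lser n).

Definition fps_prod k l (F : 'I_l -> fps k) : fps k :=
  \big[@fps_mul k/@fps_one k]_(j < l) F j.

(* X_{k+1} (0-based k), with X_{l+1} := 0 *)
Definition Xlin l (k : nat) : {mpoly rat[1 + l + l]} :=
  match (insub k : option 'I_l) with Some j => 'X_(xv j) | None => 0 end.
(* for 0-based j (1-based j+1): X_{l+1-(j+1)} - X_{l+2-(j+1)} *)
Definition Xdiff l (j : 'I_l) : {mpoly rat[1 + l + l]} :=
  Xlin l (l - 1 - j) - Xlin l (l - j).
Definition Ysum l (j : 'I_l) : {mpoly rat[1 + l + l]} :=
  \sum_(i < l | (i < l - j)%N) 'X_(yv i).

Definition summand1 l (u : {ffun 'I_l -> nat}) : fps (1 + l + l) :=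
  fps_prod (fun j : 'I_l => fps_mul (Esub (u j) 'X_(yv j)) (Lsub (u j) 'X_(xv j))).
Definition summand2 l (u : {ffun 'I_l -> nat}) : fps (1 + l + l) :=
  fps_prod (fun j : 'I_l => fps_mul (Esub (u j) (Xdiff j)) (Lsub (u j) (Ysum j))).

Definition partition_map l (i : 'I_(1 + l + l)) : {mpoly rat[1 + l + l]} :=
  match split i with
  | inl a => match split a with inl _ => 'X_(qv l) | inr j => Ysum j end
  | inr j => Xdiff j
  end.

(* Main.v *)
(* Writing L_n(X) = sum_{v>0} e^{vX} q^{nv}, every series of the theorem becomes
   a locally finite sum of terms q^N exp(linear form), indexed by pairs (u, v)
   with u_1 > ... > u_l > 0 and v_j > 0. A pair (u, v) is a partition with
   distinct parts u_j of multiplicity v_j; conjugating the partition is an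
   involution on such pairs that preserves N = sum u_j v_j and, by summation by
   parts, turns sum (u_j Y_j + v_j X_j) into
   sum (u_j (X_{l+1-j} - X_{l+2-j}) + v_j (Y_1 + ... + Y_{l+1-j})). *)
Require Import Defs.
From HB Require Import structures.
From mathcomp Require Import all_boot all_order all_algebra.
From mathcomp Require Import mpoly.
From mathcomp Require Import zify.
From Stdlib Require Import FunctionalExtensionality ClassicalEpsilon.

Set Implicit Arguments.
Unset Strict Implicit.
Unset Printing Implicit Defensive.

Import GRing.Theory Num.Theory.
Local Open Scope ring_scope.

(** * Homogeneous parts of power series and powers of linear forms *)

Lemma mcoeff_hpart k (f : fps k) d m :
  (hpart f d)@_m = if mdeg m == d then f m else 0.
Proof.
rewrite /hpart raddf_sum /=; case: eqP => [e|ne].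
  have lt : (mdeg m < d.+1)%N by rewrite e.
  rewrite (bigD1 (BMultinom lt)) /= ?e // mcoeffZ mcoeffX eqxx mulr1.
  rewrite big1 ?addr0 // => p /andP[_ nep].
  rewrite mcoeffZ mcoeffX; case: eqP => [epm|]; last by rewrite mulr0.
  by case/eqP: nep; apply/val_inj.
rewrite big1 // => p /eqP dp; rewrite mcoeffZ mcoeffX.
by case: eqP => [epm|]; rewrite ?mulr0 //; case: ne; rewrite -epm.
Qed.

(** Grouping the convolution by the degree of the left factor reduces products of series to finite
    sums of products of polynomials. *)
Lemma fps_mulE k (f g : fps k) m :
  fps_mul f g m
    = (\sum_(i < (mdeg m).+1) hpart f i * hpart g (mdeg m - i))@_m.
Proof.
rewrite raddf_sum /=.
under [RHS]eq_bigr => i _ do rewrite mcoeffM.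
rewrite exchange_big /=; apply: eq_big => [p|p /eqP em].
  by rewrite eq_sym.
have dm : (mdeg p.1 + mdeg p.2 = mdeg m)%N by rewrite -mdegD; congr mdeg.
have lt : (mdeg p.1 < (mdeg m).+1)%N by lia.
have d2 : mdeg p.2 == (mdeg m - mdeg p.1)%N by lia.
rewrite (bigD1 (Ordinal lt)) //= !mcoeff_hpart eqxx d2.
rewrite big1 ?addr0 // => i nei; rewrite mcoeff_hpart.
case: eqP => [e|]; last by rewrite mul0r.
by case/eqP: nei; apply/val_inj.
Qed.

Lemma mcoeffXM k (R : comNzRingType) (n m : 'X_{1..k}) (Q : {mpoly R[k]}) :
  ('X_[n] * Q)@_m = if (n <= m)%MM then Q@_(m - n) else 0.
Proof.
case: ifP => [le|nle].
  by rewrite mulrC -{1}(submK le) addmC mcoeffMX.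
rewrite mcoeffM big1 // => p /eqP em; rewrite mcoeffX.
case: eqP => [e|]; last by rewrite mul0r.
by rewrite em -e lem_addr in nle.
Qed.

(** The multinomial theorem, by induction on [d]: when one factor of the power is split off, its
    [i]-th term contributes a quantity independent of [i] times [m i], and the [m i] add up to
    [d.+1]. *)
Lemma mcoeff_linform_exp k (c : 'I_k -> rat) d (m : 'X_{1..k}) :
  ((\sum_i c i *: 'X_i) ^+ d)@_m
    = if mdeg m == d then d`!%:R * \prod_i (c i ^+ m i / ((m i)`!)%:R) else 0.
Proof.
elim: d m => [|d IH] m.
  rewrite expr0 mcoeff1 mdeg_eq0; case: eqP => // ->.
  by rewrite fact0 mul1r big1 // => i _; rewrite mnm0E expr0 fact0 divr1.
rewrite exprS mulr_suml raddf_sum /=.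
pose w (m : 'X_{1..k}) := \prod_i (c i ^+ m i / ((m i)`!)%:R).
have step i : (c i *: 'X_i * (\sum_i c i *: 'X_i) ^+ d)@_m =
   (if mdeg m == d.+1 then d`!%:R * w m else 0) * (m i)%:R.
  rewrite -scalerAl mcoeffZ mcoeffXM lep1mP -lt0n.
  case: ltnP => [mi|]; last by rewrite leqn0 => /eqP ->; rewrite !mulr0.
  have le : (U_(i) <= m)%MM by rewrite lep1mP -lt0n.
  have := congr1 (@mdeg k) (submK le); rewrite mdegD mdeg1 addn1 => dm.
  rewrite IH -dm eqSS; case: ifP => _; last by rewrite mulr0 mul0r.
  rewrite mulrCA -mulrA; congr (_ * _).
  rewrite /w (bigD1 i) //= [in RHS](bigD1 i) //= mnmBE mnm1E eqxx.
  rewrite mulrA [RHS]mulrAC; congr (_ * _).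
    case: (m i) mi => // e _; rewrite subSS subn0 exprS factS natrM.
    by rewrite invfM [_^-1 * _^-1]mulrC -!mulrA mulVf ?mulr1 // pnatr_eq0.
  by apply: eq_bigr => j /negPf nj; rewrite mnmBE mnm1E eq_sym nj subn0.
rewrite (eq_bigr _ (fun i _ => step i)) -mulr_sumr -natr_sum -mdegE.
case: eqP => [->|_]; last by rewrite mul0r.
by rewrite factS natrM mulrC mulrA.
Qed.

(** * Series x^n exp(p) with p a linear form *)

(* The degree-[d] part of the series [x^n exp(p)], for a linear form [p]. *)
Definition xpart k (n : 'X_{1..k}) (p : {mpoly rat[k]}) (d : nat)
    : {mpoly rat[k]} :=
  if (mdeg n <= d)%N
  then 'X_[n] * (((d - mdeg n)`!)%:R^-1 *: p ^+ (d - mdeg n)) else 0.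

(** These series are closed under products and under the substitutions used here, and every series
    of the theorem is a locally finite sum of them. *)
Definition xexp k (n : 'X_{1..k}) (p : {mpoly rat[k]}) : fps k :=
  fun m => (xpart n p (mdeg m))@_m.

Lemma hpart_xexp k (n : 'X_{1..k}) (p : {mpoly rat[k]}) d :
  p \is 1.-homog -> hpart (xexp n p) d = xpart n p d.
Proof.
move=> hp; apply/mpolyP => m; rewrite mcoeff_hpart.
case: eqP => [<- //|/eqP ne]; rewrite /xpart; case: ifP => [le|]; last first.
  by rewrite mcoeff0.
apply/esym; apply: dhomog_nemf_coeff ne.
suff : 'X_[n] * (((d - mdeg n)`!)%:R^-1 *: p ^+ (d - mdeg n))
    \is (mdeg n + 1 * (d - mdeg n)).-homog by rewrite mul1n subnKC.
by apply: dhomogM; [rewrite dhomogX | apply/rpredZ/dhomogMn].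
Qed.

(** Degree [e] of exp(x) exp(y) = exp(x + y): the binomial theorem divided by [e]!. *)
Lemma exp_part_conv (A : comAlgType rat) (x y : A) e :
  \sum_(i < e.+1) ((i`!)%:R^-1 *: x ^+ i) * (((e - i)`!)%:R^-1 *: y ^+ (e - i))
    = (e`!)%:R^-1 *: (x + y) ^+ e.
Proof.
rewrite addrC exprDn scaler_sumr; apply: eq_bigr => i _.
rewrite -scalerAl -scalerAr scalerA -scaler_nat scalerA mulrC [y ^+ _ * _]mulrC.
congr (_ *: _); have le : (i <= e)%N by rewrite -ltnS.
rewrite -(bin_fact le) !natrM invfM mulrAC mulVf ?mul1r; last first.
  by rewrite pnatr_eq0 -lt0n bin_gt0.
by rewrite invfM mulrC.
Qed.

Lemma xpart_conv k (n n' : 'X_{1..k}) (p p' : {mpoly rat[k]}) d :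
  \sum_(i < d.+1) xpart n p i * xpart n' p' (d - i)
    = xpart (n + n') (p + p') d.
Proof.
rewrite -(big_mkord xpredT (fun i => xpart n p i * xpart n' p' (d - i))).
rewrite /xpart mdegD; case: ifP => [le|nle]; last first.
  rewrite big_mkord; apply: big1 => i _; case: leqP => [l1|]; last by rewrite mul0r.
  case: leqP => [l2|]; last by rewrite mulr0.
  by have := ltn_ord i; lia.
set a := mdeg n; set b := mdeg n'; have [e de] : exists e, d = (a + e + b)%N.
  by exists (d - (a + b))%N; rewrite /a /b; lia.
(* Only a <= i <= a + e contributes: below [a] the left factor vanishes, above a + e the right one
   does. Shifting the remaining range by [a] gives [exp_part_conv]. *)
rewrite (@big_cat_nat _ _ _ a) //=; last by lia.
rewrite big_nat big1 ?add0r; last first.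
  by move=> i /andP[_ lt]; rewrite leqNgt lt mul0r.
rewrite (@big_cat_nat _ _ _ (a + e).+1) //=; [|lia|lia].
rewrite [X in _ + X]big_nat [X in _ + X]big1 ?addr0; last first.
  move=> i /andP[lt lt']; case: (leqP b) => [l2|]; last by rewrite mulr0.
  by lia.
rewrite -{1}[a]add0n big_addn.
have -> : ((a + e).+1 - a = e.+1)%N by lia.
have -> : (d - (a + b) = e)%N by lia.
rewrite -exp_part_conv mulr_sumr big_mkord; apply: eq_bigr => i _.
have lti := ltn_ord i; rewrite leq_addl addnK.
have -> : (d - (i + a) - b = e - i)%N by lia.
have -> : (b <= d - (i + a))%N by lia.
by rewrite mpolyXD mulrACA.
Qed.

Lemma fps_mul_xexp k (n n' : 'X_{1..k}) (p p' : {mpoly rat[k]}) :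
  p \is 1.-homog -> p' \is 1.-homog ->
  fps_mul (xexp n p) (xexp n' p') = xexp (n + n') (p + p').
Proof.
move=> hp hp'; apply: functional_extensionality => m.
rewrite fps_mulE /xexp -xpart_conv; congr mcoeff.
by apply: eq_bigr => i _; rewrite !hpart_xexp.
Qed.

(** [fps_subst] reads the coefficient of [m] off the component of degree [mdeg m], so the monomial
    has to be sent to a monomial of the same degree. *)
Lemma fps_subst_xexp k h (A : 'I_k -> {mpoly rat[h]}) n n' p :
  p \is 1.-homog -> mdeg n = mdeg n' ->
  'X_[n] \mPo [tuple A i | i < k] = 'X_[n'] ->
  fps_subst A (xexp n p) = xexp n' (p \mPo [tuple A i | i < k]).
Proof.
move=> hp dn eA; apply: functional_extensionality => m.
rewrite /fps_subst hpart_xexp // /xexp /xpart dn.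
case: ifP => _; last by rewrite comp_mpoly0.
by rewrite rmorphM /= eA comp_mpolyZ rmorphXn.
Qed.

Lemma xexpE k (n : 'X_{1..k}) (c : 'I_k -> rat) m :
  xexp n (\sum_i c i *: 'X_i) m
    = if (n <= m)%MM
      then \prod_i (c i ^+ (m i - n i) / ((m i - n i)`!)%:R) else 0.
Proof.
rewrite /xexp /xpart; case: ifP => [ld|nld]; last first.
  rewrite mcoeff0; case: ifP => // le.
  by move/negP: nld; rewrite -(submK le) mdegD leq_addl.
rewrite mcoeffXM; case: ifP => // le.
have dm : mdeg (m - n) = (mdeg m - mdeg n)%N by rewrite -{2}(submK le) mdegD addnK.
rewrite mcoeffZ mcoeff_linform_exp dm eqxx mulrA mulVf ?mul1r; last first.
  by rewrite pnatr_eq0 -lt0n fact_gt0.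
by apply: eq_bigr => i _; rewrite mnmBE.
Qed.

(** * Sums of power series, distributivity and truncation by degree *)

Definition fps_zero k : fps k := fun _ => 0.
Definition fps_add k (f g : fps k) : fps k := fun m => f m + g m.

Lemma fps_addA k : associative (@fps_add k).
Proof. by move=> f g h; apply: functional_extensionality => m; apply: addrA. Qed.

Lemma fps_addC k : commutative (@fps_add k).
Proof. by move=> f g; apply: functional_extensionality => m; apply: addrC. Qed.

Lemma fps_add0 k : left_id (@fps_zero k) (@fps_add k).
Proof. by move=> f; apply: functional_extensionality => m; apply: add0r. Qed.

Lemma fps_mul0l k : left_zero (@fps_zero k) (@fps_mul k).
Proof.
move=> f; apply: functional_extensionality => m.
by apply: big1 => p _; apply: mul0r.
Qed.

Lemma fps_mul0r k : right_zero (@fps_zero k) (@fps_mul k).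
Proof.
move=> f; apply: functional_extensionality => m.
by apply: big1 => p _; apply: mulr0.
Qed.

Lemma fps_mulDl k : left_distributive (@fps_mul k) (@fps_add k).
Proof.
move=> f g h; apply: functional_extensionality => m.
by rewrite /fps_mul /fps_add -big_split; apply: eq_bigr => p _; apply: mulrDl.
Qed.

Lemma fps_mulDr k : right_distributive (@fps_mul k) (@fps_add k).
Proof.
move=> f g h; apply: functional_extensionality => m.
by rewrite /fps_mul /fps_add -big_split; apply: eq_bigr => p _; apply: mulrDr.
Qed.

(** With these structures [big_distrr] and [bigA_distr_big] can expand products of finite sums of
    series. *)
HB.instance Definition _ k := Monoid.isComLaw.Build (fps k) (@fps_zero k)
  (@fps_add k) (@fps_addA k) (@fps_addC k) (@fps_add0 k).
HB.instance Definition _ k := Monoid.isMulLaw.Build (fps k) (@fps_zero k)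
  (@fps_mul k) (@fps_mul0l k) (@fps_mul0r k).
HB.instance Definition _ k := Monoid.isAddLaw.Build (fps k) (@fps_mul k)
  (@fps_add k) (@fps_mulDl k) (@fps_mulDr k).

Lemma fps_sumE k I (r : seq I) (P : pred I) (F : I -> fps k) m :
  (\big[@fps_add k/@fps_zero k]_(i <- r | P i) F i) m
    = \sum_(i <- r | P i) F i m.
Proof. by elim/big_rec2: _ => // i x f _ <-. Qed.

Lemma fps_mul_subl k (f g h : fps k) :
  fps_mul (fps_sub f g) h = fps_sub (fps_mul f h) (fps_mul g h).
Proof.
apply: functional_extensionality => m.
by rewrite /fps_mul /fps_sub -sumrB; apply: eq_bigr => p _; apply: mulrBl.
Qed.

Lemma fps_mul1l k (f : fps k) : fps_mul (@fps_one k) f = f.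
Proof.
apply: functional_extensionality => m; rewrite fps_mulE big_ord_recl big1.
  have -> : hpart (@fps_one k) 0 = 1.
    apply/mpolyP => n; rewrite mcoeff_hpart mcoeff1 mdeg_eq0 /fps_one.
    by case: eqP.
  by rewrite addr0 mul1r subn0 mcoeff_hpart eqxx.
move=> i _; have -> : hpart (@fps_one k) (lift ord0 i) = 0.
  apply/mpolyP => n; rewrite mcoeff_hpart mcoeff0 /fps_one.
  by case: eqP => // dn; case: eqP => // n0; rewrite n0 mdeg0 in dn.
by rewrite mul0r.
Qed.

(** Congruence modulo degree above [D]. It lets a finite partial sum stand for an infinite one
    wherever a single coefficient is computed. *)
Definition eq_upto k D (f g : fps k) :=
  forall m, (mdeg m <= D)%N -> f m = g m.

Lemma fps_mul_upto k D (f f' g g' : fps k) :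
  eq_upto D f f' -> eq_upto D g g' -> eq_upto D (fps_mul f g) (fps_mul f' g').
Proof.
move=> ef eg m le; apply: eq_bigr => p _.
by rewrite ef ?eg //; apply: leq_trans le; rewrite -ltnS bmdeg.
Qed.

Lemma fps_prod_upto k l D (F G : 'I_l -> fps k) :
  (forall j, eq_upto D (F j) (G j)) -> eq_upto D (fps_prod F) (fps_prod G).
Proof.
move=> e; rewrite /fps_prod; elim/big_rec2: _ => // j f g _ IH.
exact: fps_mul_upto.
Qed.

Lemma fps_subst_upto k h D (A : 'I_k -> {mpoly rat[h]}) (f g : fps k) :
  eq_upto D f g -> eq_upto D (fps_subst A f) (fps_subst A g).
Proof.
move=> e m le; rewrite /fps_subst; congr (mcoeff m (comp_mpoly _ _)).
by apply/mpolyP => n; rewrite !mcoeff_hpart; case: eqP => // dn; rewrite e ?dn.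
Qed.

Lemma fps_subst_sum k h (A : 'I_k -> {mpoly rat[h]}) I (r : seq I) (P : pred I)
    (F : I -> fps k) m :
  fps_subst A (\big[@fps_add k/@fps_zero k]_(i <- r | P i) F i) m
    = \sum_(i <- r | P i) fps_subst A (F i) m.
Proof.
rewrite /fps_subst; set d := mdeg m.
have -> : hpart (\big[@fps_add k/@fps_zero k]_(i <- r | P i) F i) d
        = \sum_(i <- r | P i) hpart (F i) d.
  apply/mpolyP => n; rewrite mcoeff_hpart raddf_sum /= fps_sumE.
  case: ifP => e; last by rewrite big1 // => i _; rewrite mcoeff_hpart e.
  by apply: eq_bigr => i _; rewrite mcoeff_hpart e.
by rewrite (big_morph _ (comp_mpolyD _) (comp_mpoly0 _)) raddf_sum.
Qed.

Lemma xexp_small k (n : 'X_{1..k}) p m :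
  (mdeg m < mdeg n)%N -> xexp n p m = 0.
Proof. by move=> lt; rewrite /xexp /xpart leqNgt lt mcoeff0. Qed.

(** * Monomials and exponentials in the form [xexp] *)

Lemma fps_mono_xexp k (n : 'X_{1..k}) : fps_mono n = xexp n 0.
Proof.
apply: functional_extensionality => m; rewrite /fps_mono.
case: eqP => [->|/eqP ne].
  by rewrite /xexp /xpart leqnn subnn expr0 fact0 invr1 scale1r mulr1 mcoeffX eqxx.
rewrite /xexp /xpart; case: leqP => [le|]; last by rewrite mcoeff0.
case e : (mdeg m - mdeg n)%N => [|e'].
  by rewrite expr0 fact0 invr1 scale1r mulr1 mcoeffX eq_sym (negPf ne).
by rewrite exprS mul0r scaler0 mulr0 mcoeff0.
Qed.

Lemma fps_one_xexp k : @fps_one k = xexp 0%MM 0.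
Proof. exact: fps_mono_xexp. Qed.

Lemma dhomog_var k i : ('X_i : {mpoly rat[k]}) \is 1.-homog.
Proof. by rewrite dhomogX /= mdeg1. Qed.

Lemma linformZ k c (p : {mpoly rat[k]}) :
  p \is 1.-homog -> c *: p \is 1.-homog.
Proof. exact: rpredZ. Qed.

Lemma linformD k (p p' : {mpoly rat[k]}) :
  p \is 1.-homog -> p' \is 1.-homog -> p + p' \is 1.-homog.
Proof. exact: rpredD. Qed.

Lemma fps_expo_xexp c : fps_expo c = xexp 0%MM (c *: 'X_(ord0 : 'I_1)).
Proof.
apply: functional_extensionality => m.
have -> : c *: 'X_(ord0 : 'I_1) = \sum_(i < 1) c *: 'X_i :> {mpoly rat[1]}.
  by rewrite big_ord1.
rewrite xexpE big_ord1 mnm0E subn0.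
have -> // : (0 <= m)%MM by apply/mnm_lepP => i; rewrite mnm0E.
Qed.

Lemma comp_mpolyX0 k h (A : k.-tuple {mpoly rat[h]}) :
  'X_[0%MM] \mPo A = 'X_[0%MM].
Proof. by rewrite !mpolyX0 comp_mpoly1. Qed.

Lemma comp_mpoly_var k h (A : 'I_k -> {mpoly rat[h]}) i :
  'X_i \mPo [tuple A i | i < k] = A i.
Proof. by rewrite comp_mpolyXU -tnth_nth tnth_mktuple. Qed.

Lemma fps_subst_expo h (p : {mpoly rat[h]}) c :
  fps_subst (fun _ : 'I_1 => p) (fps_expo c) = xexp 0%MM (c *: p).
Proof.
rewrite fps_expo_xexp (@fps_subst_xexp _ _ _ _ 0%MM) ?mdeg0 ?comp_mpolyX0 //.
  by rewrite comp_mpolyZ comp_mpoly_var.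
exact/linformZ/dhomog_var.
Qed.

(** * The geometric series of L_n, with terms e^{vX} q^{nv} *)

Definition Lterm (n v : nat) : fps 2 :=
  xexp (U_(ord0) *+ (n * v))%MM (v%:R *: 'X_ord_max).

Definition Lgeom (n D : nat) : fps 2 :=
  \big[@fps_add 2/@fps_zero 2]_(1 <= v < D.+1) Lterm n v.

Lemma eXqn_Lterm n : eXqn n = Lterm n 1.
Proof.
rewrite /eXqn /eX2 fps_subst_expo fps_mono_xexp fps_mul_xexp ?rpred0 //.
  by rewrite add0m addr0 /Lterm muln1.
exact/linformZ/dhomog_var.
Qed.

Lemma Lterm_mul n v : fps_mul (Lterm n 1) (Lterm n v) = Lterm n v.+1.
Proof.
rewrite fps_mul_xexp; try exact/linformZ/dhomog_var.
rewrite /Lterm -scalerDl -natrD add1n; congr xexp.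
by apply/mnmP => i; rewrite mnmDE !mulmnE; lia.
Qed.

Lemma Lterm_small n v m : (0 < n)%N -> (mdeg m < v)%N -> Lterm n v m = 0.
Proof. by move=> n0 lt; apply: xexp_small; rewrite mdegMn mdeg1 mul1n; nia. Qed.

Lemma Lgeom_stable n D D' m : (0 < n)%N -> (mdeg m <= D)%N -> (D <= D')%N ->
  Lgeom n D m = Lgeom n D' m.
Proof.
move=> n0 le le'; rewrite /Lgeom !fps_sumE (@big_cat_nat _ _ _ D.+1 1 D'.+1) //=.
rewrite [X in _ + X]big_nat [X in _ + X]big1 ?addr0 // => v /andP[lt _].
by apply: Lterm_small => //; lia.
Qed.

(** Since [g] has no constant term, a coefficient of g h involves only coefficients of [h] of
    smaller degree, so strong induction on the degree recovers [h] from (1 - g) h. *)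
Lemma fps_one_sub_inj k (g h h' : fps k) : (forall m, mdeg m = 0%N -> g m = 0) ->
  fps_mul (fps_sub (@fps_one k) g) h = fps_mul (fps_sub (@fps_one k) g) h' ->
  h = h'.
Proof.
move=> g0; rewrite !fps_mul_subl !fps_mul1l => e.
apply: functional_extensionality => m.
have [d] := ubnP (mdeg m); elim: d m => // d IH m; rewrite ltnS => ltd.
suff eg : fps_mul g h m = fps_mul g h' m.
  by have := congr1 (@^~ m) e; rewrite /fps_sub eg; apply: addIr.
apply: eq_bigr => p /eqP em.
have dm : (mdeg p.1 + mdeg p.2 = mdeg m)%N by rewrite -mdegD; congr mdeg.
have [d0|d1] := posnP (mdeg p.1); first by rewrite g0 // !mul0r.
have lt : (mdeg p.2 < d)%N by lia.
by rewrite (IH _ lt).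
Qed.

(** [fps_div] chooses a solution of a linear equation by [epsilon]. The geometric series solves that
    equation, and the solution is unique by [fps_one_sub_inj]. *)
Lemma Lser_geom n D : (0 < n)%N -> eq_upto D (Lser n) (Lgeom n D).
Proof.
move=> n0; pose G : fps 2 := fun m => Lgeom n (mdeg m) m.
have GD E : eq_upto E G (Lgeom n E) by move=> m le; apply: Lgeom_stable.
suff -> : Lser n = G by [].
have eG : fps_mul (fps_sub (@fps_one 2) (eXqn n)) G = eXqn n.
  apply: functional_extensionality => m; rewrite eXqn_Lterm.
  rewrite fps_mul_subl fps_mul1l /fps_sub.
  rewrite (@fps_mul_upto _ (mdeg m) (Lterm n 1) (Lterm n 1) G _ _ (GD _)) //.
  rewrite /G /Lgeom big_distrr !fps_sumE.
  under [X in _ - X]eq_bigr => v _ do rewrite /= Lterm_mul.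
  apply/eqP; rewrite -sumrB -eqr_opp -sumrN.
  under eq_bigr => v _ do rewrite opprB.
  (* The end term of the telescope, of index [(mdeg m).+1], has q-exponent too large to contribute
     at [m]. *)
  by rewrite telescope_sumr // (@Lterm_small n _.+1) // sub0r.
apply: (@fps_one_sub_inj _ (eXqn n)).
  move=> m d0; rewrite eXqn_Lterm; apply: Lterm_small => //; by rewrite d0.
rewrite eG; apply: (epsilon_spec (inhabits (fun _ => 0))
  (fun h => fps_mul (fps_sub (@fps_one 2) (eXqn n)) h = eXqn n)).
by exists G.
Qed.

(** * Expansion of the products of E and L *)

Definition qmon l (N : nat) : 'X_{1..1 + l + l} := (U_(qv l) *+ N)%MM.

Lemma Esub_xexp l n (p : {mpoly rat[1 + l + l]}) :
  Esub n p = xexp (qmon l 0) (n%:R *: p).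
Proof. by rewrite /Esub /Eser fps_subst_expo. Qed.

Lemma fps_subst_qmon h l (A : 'I_h -> {mpoly rat[1 + l + l]}) i N p :
  p \is 1.-homog -> A i = 'X_(qv l) ->
  fps_subst A (xexp (U_(i) *+ N)%MM p)
    = xexp (qmon l N) (p \mPo [tuple A i | i < h]).
Proof.
move=> hp Ai; apply: fps_subst_xexp => //; first by rewrite !mdegMn !mdeg1.
by rewrite /qmon -!mpolyXn rmorphXn /= comp_mpoly_var Ai.
Qed.

Lemma Lsub_xexp l n (p : {mpoly rat[1 + l + l]}) D : (0 < n)%N ->
  eq_upto D (Lsub n p)
    (\big[@fps_add _/@fps_zero _]_(v < D.+1 | (0 < v)%N)
       xexp (qmon l (n * v)) (v%:R *: p)).
Proof.
move=> n0 m le; rewrite /Lsub (fps_subst_upto _ (@Lser_geom n D n0)) //.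
rewrite /Lgeom fps_subst_sum fps_sumE.
rewrite -(big_mkord (fun v => (0 < v)%N)
  (fun v => xexp (qmon l (n * v)) (v%:R *: p) m)).
rewrite [RHS]big_ltn_cond //= big_nat [RHS]big_nat_cond.
apply: eq_big => [v|v /andP[v0 _]]; first by lia.
rewrite (fps_subst_qmon (i := ord0)) //; last exact/linformZ/dhomog_var.
by rewrite comp_mpolyZ comp_mpoly_var.
Qed.

Lemma fps_prod_xexp l (N : 'I_l -> nat) (p : 'I_l -> {mpoly rat[1 + l + l]}) :
  (forall j, p j \is 1.-homog) ->
  fps_prod (fun j => xexp (qmon l (N j)) (p j))
    = xexp (qmon l (\sum_j N j)) (\sum_j p j).
Proof.
move=> hp; rewrite /fps_prod.
(* Linearity of the partial sums is carried through the induction because [fps_mul_xexp] requires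
   it. *)
suff [] : \big[@fps_mul _/@fps_one _]_j xexp (qmon l (N j)) (p j)
    = xexp (qmon l (\sum_j N j)) (\sum_j p j) /\ \sum_j p j \is 1.-homog by [].
elim/big_rec3: _ => [|j y a f _ [-> hy]].
  by rewrite fps_one_xexp rpred0.
rewrite fps_mul_xexp // rpredD //; split=> //.
congr xexp; by apply/mnmP => i; rewrite /qmon mnmDE !mulmnE; lia.
Qed.

(** Each L is replaced by its geometric sum up to [D]. Distributing the product over these sums
    amounts to choosing one multiplicity v_j for every j, and each choice gives a single [xexp]. *)
Lemma EL_prod l (u : 'I_l -> nat) (e f : 'I_l -> {mpoly rat[1 + l + l]}) D m :
  (forall j, 0 < u j)%N -> (forall j, e j \is 1.-homog) ->
  (forall j, f j \is 1.-homog) -> (mdeg m <= D)%N ->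
  fps_prod (fun j => fps_mul (Esub (u j) (e j)) (Lsub (u j) (f j))) m
    = \sum_(v : {ffun 'I_l -> 'I_D.+1} | [forall j, (0 < v j)%N])
        xexp (qmon l (\sum_j u j * v j))
          (\sum_j ((u j)%:R *: e j + (v j)%:R *: f j)) m.
Proof.
move=> u0 he hf le.
pose G j := \big[@fps_add _/@fps_zero _]_(v < D.+1 | (0 < v)%N)
   xexp (qmon l (u j * v)) ((u j)%:R *: e j + v%:R *: f j).
rewrite (@fps_prod_upto _ _ D _ G) //; last first.
  move=> j m' le'; rewrite Esub_xexp.
  rewrite (fps_mul_upto (fun _ _ => erefl) (Lsub_xexp _ (u0 j)) le').
  rewrite big_distrr /= /G !fps_sumE; apply: eq_bigr => v _.
  rewrite fps_mul_xexp ?linformZ //; congr (xexp _ _ m').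
  by apply/mnmP => i; rewrite /qmon mnmDE !mulmnE; lia.
rewrite /fps_prod bigA_distr_big fps_sumE; apply: eq_big => [v|v _].
  by apply/ffun_onP/forallP.
rewrite -/(fps_prod _) fps_prod_xexp // => j.
by rewrite linformD ?linformZ.
Qed.

(** * Reindexing finite sums, and boxes of index functions *)

Lemma sum_reindex (T : eqType) (s s' : seq T) (P : pred T) (phi : T -> T)
    (F : T -> rat) :
  uniq s -> uniq s' ->
  (forall w, P w -> P (phi w)) -> (forall w, P w -> phi (phi w) = w) ->
  (forall w, P w -> F w != 0 -> w \in s') ->
  (forall w, P w -> F (phi w) != 0 -> w \in s) ->
  \sum_(w <- s | P w) F (phi w) = \sum_(w <- s' | P w) F w.
Proof.
move=> us us' Pphi phiK hs' hs.
have nz r (G : T -> rat) :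
    \sum_(w <- r | P w) G w = \sum_(w <- r | P w && (G w != 0)) G w.
  rewrite [RHS]big_mkcondr; apply: eq_bigr => w _.
  by case: eqP => [->|].
(* Once the zero terms are discarded, [phi] is a bijection between the two supports, so neither list
   has to be stable under [phi]. *)
rewrite nz [RHS]nz -big_filter -[RHS]big_filter -(big_map phi xpredT F).
apply/perm_big/uniq_perm; rewrite ?filter_uniq //.
  rewrite map_inj_in_uniq ?filter_uniq // => x y.
  rewrite !mem_filter => /andP[/andP[Px _] _] /andP[/andP[Py _] _] e.
  by rewrite -(phiK x Px) e phiK.
move=> x; rewrite mem_filter; apply/mapP/idP.
  move=> [w]; rewrite mem_filter => /andP[/andP[Pw nw] _] ->.
  by rewrite Pphi //= nw /= hs' // Pphi.
move=> /andP[/andP[Px nx] _]; exists (phi x); last by rewrite phiK.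
by rewrite mem_filter Pphi //= phiK // nx hs ?Pphi ?phiK.
Qed.

Lemma sum_support (T : eqType) (s s' : seq T) (P : pred T) (F : T -> rat) :
  uniq s -> uniq s' ->
  (forall w, P w -> F w != 0 -> w \in s) ->
  (forall w, P w -> F w != 0 -> w \in s') ->
  \sum_(w <- s | P w) F w = \sum_(w <- s' | P w) F w.
Proof. by move=> us us' hs hs'; apply: (sum_reindex (phi := id)). Qed.

(** The values are natural numbers rather than ordinals, since conjugation may leave the box. *)
Definition box l D : seq {ffun 'I_l -> nat} :=
  [seq [ffun j => nat_of_ord (v j)] |
     v : {ffun 'I_l -> 'I_D.+1} <- enum {: {ffun 'I_l -> 'I_D.+1}}].

Lemma box_uniq l D : uniq (box l D).
Proof.
rewrite map_inj_uniq ?enum_uniq // => v w /ffunP e.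
by apply/ffunP => j; apply/val_inj; have := e j; rewrite !ffunE.
Qed.

Lemma mem_box l D (u : {ffun 'I_l -> nat}) :
  (forall j, u j <= D)%N -> u \in box l D.
Proof.
move=> h; apply/mapP; exists [ffun j => inord (u j)]; first by rewrite mem_enum.
by apply/ffunP => j; rewrite !ffunE inordK // ltnS h.
Qed.

Lemma big_box l D (P : pred {ffun 'I_l -> nat}) (F : {ffun 'I_l -> nat} -> rat) :
  \sum_(u <- box l D | P u) F u
    = \sum_(v : {ffun 'I_l -> 'I_D.+1} | P [ffun j => nat_of_ord (v j)])
        F [ffun j => nat_of_ord (v j)].
Proof. by rewrite big_map big_enum_cond. Qed.

(** * The generating series as a sum over admissible pairs *)

Definition all_pos l (v : 'I_l -> nat) : bool := [forall j, (0 < v j)%N].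

Lemma eq_all_pos l (u v : 'I_l -> nat) : u =1 v -> all_pos u = all_pos v.
Proof. by move=> e; apply: eq_forallb => j; rewrite e. Qed.

Lemma eq_pos_dec l (u v : 'I_l -> nat) : u =1 v -> pos_dec u = pos_dec v.
Proof.
move=> e; congr (_ && _); last exact: eq_all_pos.
by apply: eq_forallb => i; apply: eq_forallb => j; rewrite !e.
Qed.

Lemma pos_dec_pos l (u : 'I_l -> nat) : pos_dec u -> all_pos u.
Proof. by case/andP. Qed.

(** The term of index (u, v) common to both expansions: [e] holds the arguments of the E factors and
    [f] those of the L factors. *)
Definition biexp l (e f : 'I_l -> {mpoly rat[1 + l + l]})
    (w : {ffun 'I_l -> nat} * {ffun 'I_l -> nat}) : fps (1 + l + l) :=
  xexp (qmon l (\sum_j w.1 j * w.2 j))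
    (\sum_j ((w.1 j)%:R *: e j + (w.2 j)%:R *: f j)).

Definition Tterm l := biexp (fun j : 'I_l => 'X_(yv j)) (fun j => 'X_(xv j)).

Definition adm l (w : {ffun 'I_l -> nat} * {ffun 'I_l -> nat}) : bool :=
  pos_dec w.1 && all_pos w.2.

Definition boxes l D E := [seq (u, v) | u <- box l D, v <- box l E].

Lemma boxes_uniq l D E : uniq (boxes l D E).
Proof. by apply: allpairs_uniq; rewrite ?box_uniq // => -[? ?] [? ?]. Qed.

Lemma big_boxes l D E (F : _ -> rat) :
  \sum_(w <- boxes l D E | adm w) F w
    = \sum_(u <- box l D | pos_dec u) \sum_(v <- box l E | all_pos v) F (u, v).
Proof.
rewrite big_mkcond big_allpairs [RHS]big_mkcond; apply: eq_bigr => u _.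
rewrite /adm /=; case: (pos_dec u) => /=; last by rewrite big1.
by rewrite -big_mkcond.
Qed.

Lemma big_split3 (R : Type) (idx : R) (op : Monoid.com_law idx) l
    (F : 'I_(1 + l + l) -> R) :
  \big[op/idx]_i F i
    = op (F (qv l)) (\big[op/idx]_(j < l) op (F (yv j)) (F (xv j))).
Proof.
rewrite big_split_ord big_split_ord big_ord1 big_split /=.
by rewrite -Monoid.mulmA; congr (op _ _); apply: Monoid.mulmC.
Qed.

Lemma qmonE l N i : qmon l N i = if i == qv l then N else 0%N.
Proof. by rewrite /qmon mulmnE mnm1E eq_sym; case: eqP => _; rewrite ?mul1n. Qed.

Lemma xv_neq_qv l (j : 'I_l) : (xv j == qv l) = false.
Proof. by apply/eqP => /(congr1 val). Qed.

Lemma yv_neq_qv l (j : 'I_l) : (yv j == qv l) = false.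
Proof. by apply/eqP => /(congr1 val). Qed.

Lemma TtermE l (w : {ffun 'I_l -> nat} * {ffun 'I_l -> nat}) m :
  Tterm w m = if (\sum_j w.1 j * w.2 j)%N == m (qv l) then
    \prod_j ((w.1 j)%:R ^+ m (yv j) / ((m (yv j))`!)%:R
             * ((w.2 j)%:R ^+ m (xv j) / ((m (xv j))`!)%:R)) else 0.
Proof.
case: w => u v; rewrite /Tterm /biexp /=; set N := (\sum_j _)%N.
(* The linear form is written over all variables, with coefficient 0 at q. Its exponential then
   gives q the factor 0^(m_q - N), which vanishes unless m_q = N. *)
pose c (i : 'I_(1 + l + l)) : rat := match split i with
  | inl a => match split a with inl _ => 0 | inr j => (v j)%:R end
  | inr j => (u j)%:R end.
have cq : c (qv l) = 0 by rewrite /c /qv (unsplitK (inl _)) (unsplitK (inl _)).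
have cx j : c (xv j) = (v j)%:R.
  by rewrite /c /xv (unsplitK (inl _)) (unsplitK (inr _)).
have cy j : c (yv j) = (u j)%:R by rewrite /c /yv (unsplitK (inr _)).
have -> : \sum_j ((u j)%:R *: 'X_(yv j) + (v j)%:R *: 'X_(xv j))
        = \sum_i c i *: 'X_i :> {mpoly rat[1 + l + l]}.
  rewrite [RHS]big_split3 /= cq scale0r add0r.
  by apply: eq_bigr => j _; rewrite cx cy.
rewrite xexpE [\prod_i _]big_split3 /= cq qmonE eqxx.
case: ifP => [/mnm_lepP/(_ (qv l))|]; rewrite ?qmonE ?eqxx => le.
  case: eqP => [->|ne].
    rewrite subnn expr0 fact0 divr1 mul1r; apply: eq_bigr => j _.
    by rewrite !qmonE xv_neq_qv yv_neq_qv !subn0 cx cy.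
  have : (0 < m (qv l) - N)%N by lia.
  by case: (_ - _)%N => // d _; rewrite exprS !mul0r.
case: eqP => // e; case/mnm_lepP: le => i; rewrite qmonE e.
by case: eqP => // ->.
Qed.

Lemma Tterm_weight l (w : {ffun 'I_l -> nat} * {ffun 'I_l -> nat}) m :
  Tterm w m != 0 -> (\sum_j w.1 j * w.2 j)%N = m (qv l).
Proof. by rewrite TtermE; case: ifP => [/eqP-> //|_]; rewrite eqxx. Qed.

Lemma Tgen_boxes l m :
  Tgen m = \sum_(w <- boxes l (m (qv l)) (m (qv l)) | adm w) Tterm w m.
Proof.
rewrite big_boxes /Tgen /bibracket big_box [RHS]big_mkcond.
apply: eq_bigr => u _; rewrite (eq_pos_dec (ffunE _)).
case: ifP => pu; last by rewrite big1 // => v /= /andP[].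
rewrite big_box big_mkcond [RHS]big_mkcond; apply: eq_bigr => v _.
rewrite (eq_all_pos (ffunE _)) -/(all_pos _) TtermE /=.
have -> : (\sum_j [ffun j => nat_of_ord (u j)] j
             * [ffun j => nat_of_ord (v j)] j = \sum_j u j * v j)%N.
  by apply: eq_bigr => j _; rewrite !ffunE.
case: (all_pos _) => //=; case: eqP => // _; apply: eq_bigr => j _.
by rewrite !ffunE !natrX subn1 /= !mulrA.
Qed.

(** All u_j and v_j are positive and u_j v_j <= N, hence both are at most N. *)
Lemma adm_boxes l D E N (w : {ffun 'I_l -> nat} * {ffun 'I_l -> nat}) :
  (N <= D)%N -> (N <= E)%N -> adm w -> (\sum_j w.1 j * w.2 j)%N = N ->
  w \in boxes l D E.
Proof.
case: w => u v /= ND NE /andP[/pos_dec_pos/forallP u0 /forallP v0] /= e.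
have le j : (u j * v j <= N)%N by rewrite -e (bigD1 j) //= leq_addr.
apply/allpairsP; exists (u, v); split=> //=; apply: mem_box => j;
  by have := le j; have := u0 j; have := v0 j => /= *; nia.
Qed.

Lemma Tgen_boxesW l D E (m : 'X_{1..1 + l + l}) :
  (m (qv l) <= D)%N -> (m (qv l) <= E)%N ->
  Tgen m = \sum_(w <- boxes l D E | adm w) Tterm w m.
Proof.
move=> lD lE; rewrite Tgen_boxes.
by apply: sum_support; rewrite ?boxes_uniq // => w aw /Tterm_weight e;
  apply: adm_boxes e.
Qed.

(** * Conjugation of partitions and summation by parts *)

Definition ext0 l (f : 'I_l -> nat) (k : nat) : nat :=
  if insub k is Some j then f j else 0%N.

Lemma ext0_ord l (f : 'I_l -> nat) (j : 'I_l) : ext0 f j = f j.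
Proof. by rewrite /ext0 valK. Qed.

Lemma ext0_ge l (f : 'I_l -> nat) k : (l <= k)%N -> ext0 f k = 0%N.
Proof. by move=> le; rewrite /ext0 insubN // -leqNgt. Qed.

(** The distinct parts of the conjugate partition: in 1-based indices, v_1 + ... + v_{l+1-j} counts
    the parts of size at least u_{l+1-j}. *)
Definition psums l (v : {ffun 'I_l -> nat}) : {ffun 'I_l -> nat} :=
  [ffun j : 'I_l => (\sum_(i < l | (i < l - j)%N) v i)%N].

(** The multiplicities in the conjugate partition, u_{l+1-j} - u_{l+2-j} with the convention u_{l+1}
    = 0 supplied by [ext0]. *)
Definition diffs l (u : {ffun 'I_l -> nat}) : {ffun 'I_l -> nat} :=
  [ffun j : 'I_l => (ext0 u (l - 1 - j) - ext0 u (l - j))%N].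

Lemma psum_recr l (v : 'I_l -> nat) (k : 'I_l) :
  (\sum_(i < l | (i < k.+1)%N) v i = \sum_(i < l | (i < k)%N) v i + v k)%N.
Proof.
rewrite (bigD1 k) //= addnC; congr (_ + _)%N; apply: eq_bigl => i.
by rewrite ltnS ltn_neqAle andbC.
Qed.

Lemma psum_lt l (v : 'I_l -> nat) a b : all_pos v -> (a < b <= l)%N ->
  (\sum_(i < l | (i < a)%N) v i < \sum_(i < l | (i < b)%N) v i)%N.
Proof.
move=> /forallP v0; elim: b => // b IH /andP[]; rewrite ltnS => ab bl.
rewrite (psum_recr v (Ordinal bl)) /=; have := v0 (Ordinal bl).
move: ab; rewrite leq_eqVlt => /orP[/eqP->|ab]; first by lia.
by have := IH; rewrite ab (ltnW bl) => /(_ isT) /=; lia.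
Qed.

Lemma ext0_psums l (v : {ffun 'I_l -> nat}) k :
  ext0 (psums v) k = (\sum_(i < l | (i < l - k)%N) v i)%N.
Proof.
case: (ltnP k l) => [lt|le].
  by rewrite -[k]/(val (Ordinal lt)) ext0_ord ffunE.
rewrite ext0_ge // big_pred0 // => i; have -> : (l - k = 0)%N by lia.
by [].
Qed.

Lemma psumsK l : cancel (@psums l) (@diffs l).
Proof.
move=> v; apply/ffunP => j; rewrite ffunE !ext0_psums; have lt := ltn_ord j.
have -> : (l - (l - 1 - j) = j.+1)%N by lia.
have -> : (l - (l - j) = j)%N by lia.
by rewrite psum_recr addKn.
Qed.

Lemma psums_pos_dec l (v : {ffun 'I_l -> nat}) :
  all_pos v -> pos_dec (psums v).
Proof.
move=> v0; apply/andP; split; apply/forallP => i.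
  apply/forallP => j; apply/implyP => ij; rewrite !ffunE; apply: psum_lt => //.
  by have := ltn_ord j; lia.
rewrite ffunE; have := @psum_lt l v 0 (l - i) v0.
have lti := ltn_ord i; rewrite big_pred0 //; apply; lia.
Qed.

Lemma ext0_lt l (u : {ffun 'I_l -> nat}) k : pos_dec u -> (k < l)%N ->
  (ext0 u k.+1 < ext0 u k)%N.
Proof.
move=> /andP[/forallP dec /forallP pos] lt.
rewrite -[k in (_ < ext0 u k)%N]/(val (Ordinal lt)) ext0_ord.
(* At the last index the drop is to the default value 0, and the inequality is the positivity of
   [u]. *)
case: (ltnP k.+1 l) => [lt'|le]; last by rewrite ext0_ge // pos.
rewrite -[k.+1]/(val (Ordinal lt')) ext0_ord.
have /forallP/(_ (Ordinal lt'))/implyP := dec (Ordinal lt); exact.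
Qed.

Lemma diffs_pos l (u : {ffun 'I_l -> nat}) : pos_dec u -> all_pos (diffs u).
Proof.
move=> pu; apply/forallP => j; rewrite ffunE subn_gt0; have lt := ltn_ord j.
have -> : (l - j = (l - 1 - j).+1)%N by lia.
by apply: ext0_lt => //; lia.
Qed.

Lemma diffsK l (u : {ffun 'I_l -> nat}) : pos_dec u -> psums (diffs u) = u.
Proof.
move=> pu; apply/ffunP => j; rewrite ffunE -(ext0_ord u j).
(* The differences telescope upwards from the smallest part, starting at [ext0 u l], which is 0. *)
suff H k : (k <= l)%N ->
    (\sum_(i < l | (i < k)%N) diffs u i)%N = ext0 u (l - k).
  by have lt := ltn_ord j; rewrite H; [congr ext0; lia | lia].
elim: k => [_|k IH lt]; first by rewrite big_pred0 // subn0 ext0_ge.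
rewrite (psum_recr _ (Ordinal lt)) /= IH ?(ltnW lt) // ffunE /=.
have -> : (l - k = (l - k.+1).+1)%N by lia.
have -> : (l - 1 - k = l - k.+1)%N by lia.
by rewrite addnC subnK // ltnW // ext0_lt //; lia.
Qed.

(** Abel summation. Values in a module allow two uses: on linear forms in [conj_termE] and on
    numbers in [conjugate_weight]. *)
Lemma sum_by_parts l (V : lmodType rat) (u : {ffun 'I_l -> nat}) (X : nat -> V) :
  pos_dec u -> X l = 0 ->
  \sum_(j < l) (u j)%:R *: (X (l - 1 - j)%N - X (l - j)%N)
    = \sum_(i < l) (diffs u i)%:R *: X i.
Proof.
move=> pu Xl; pose e k : rat := (ext0 u k)%:R.
transitivity (\sum_(0 <= i < l) e (l - i.+1)%N *: (X i - X i.+1)).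
  rewrite big_nat_rev big_mkord add0n; apply: eq_bigr => j _ /=.
  have lt := ltn_ord j; have -> : (l - (l - j.+1).+1 = j)%N by lia.
  rewrite /e ext0_ord; congr (_ *: (X _ - X _)); lia.
transitivity (\sum_(0 <= i < l) (e (l - i.+1)%N - e (l - i)%N) *: X i); last first.
  rewrite big_mkord; apply: eq_bigr => j _; rewrite ffunE; have lt := ltn_ord j.
  have -> : (l - 1 - j = l - j.+1)%N by lia.
  rewrite natrB //; have -> : (l - j = (l - j.+1).+1)%N by lia.
  by apply/ltnW/ext0_lt => //; lia.
under eq_bigr => i _ do rewrite scalerBr.
under [RHS]eq_bigr => i _ do rewrite scalerBl.
rewrite !sumrB; congr (_ - _).
(* The two remaining sums differ by a shift of [Y]. Both boundary terms vanish: [Y l] because X l =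
   0, and [Y 0] because [ext0 u l] is 0. *)
pose Y i := e (l - i)%N *: X i.
have : \sum_(0 <= i < l.+1) Y i = Y 0%N + \sum_(0 <= i < l) Y i.+1.
  exact: big_nat_recl.
rewrite big_nat_recr //= {2}/Y subnn Xl scaler0 addr0 => ->.
by rewrite /Y subn0 /e ext0_ge // scale0r add0r.
Qed.

Lemma Xlin_l l : Xlin l l = 0.
Proof. by rewrite /Xlin insubN // ltnn. Qed.

Lemma Xlin_ord l (j : 'I_l) : Xlin l j = 'X_(xv j).
Proof. by rewrite /Xlin valK. Qed.

(** The condition i < l - j says i + j < l, which is symmetric in i and j, so the double sum can be
    exchanged. *)
Lemma sum_Ysum l (v : {ffun 'I_l -> nat}) :
  \sum_j (v j)%:R *: Ysum j = \sum_i (psums v i)%:R *: 'X_(yv i).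
Proof.
under eq_bigr => j _ do rewrite /Ysum scaler_sumr.
rewrite (exchange_big_dep xpredT) //=; apply: eq_bigr => i _.
rewrite ffunE natr_sum scaler_suml; apply: eq_bigl => j.
by have := ltn_ord i; have := ltn_ord j; lia.
Qed.

(* Conjugation of the partition with parts u_j of multiplicity v_j. *)
Definition conjugate l (w : {ffun 'I_l -> nat} * {ffun 'I_l -> nat}) :=
  (psums w.2, diffs w.1).

Lemma conjugate_adm l (w : {ffun 'I_l -> nat} * {ffun 'I_l -> nat}) :
  adm w -> adm (conjugate w).
Proof. by case/andP=> pu pv; rewrite /adm psums_pos_dec ?diffs_pos. Qed.

Lemma conjugateK l (w : {ffun 'I_l -> nat} * {ffun 'I_l -> nat}) :
  adm w -> conjugate (conjugate w) = w.
Proof. by case: w => u v /andP[pu _]; rewrite /conjugate /= psumsK diffsK. Qed.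

Lemma conjugate_weight l (w : {ffun 'I_l -> nat} * {ffun 'I_l -> nat}) :
  adm w -> (\sum_j w.1 j * w.2 j)%N
    = (\sum_j (conjugate w).1 j * (conjugate w).2 j)%N.
Proof.
case: w => u v /andP[/= pu _].
(* With these partial sums X (l - 1 - j) - X (l - j) is v_j, so Abel summation applies to the
   weight. *)
pose X k : rat^o := (\sum_(i < l | (i < l - k)%N) v i)%:R.
have Xl : X l = 0 by rewrite /X subnn big_pred0.
apply/eqP; rewrite -(eqr_nat rat) !natr_sum; apply/eqP.
transitivity (\sum_(j < l) (u j)%:R *: (X (l - 1 - j)%N - X (l - j)%N)).
  apply: eq_bigr => j _; have lt := ltn_ord j; rewrite /X.
  have -> : (l - (l - 1 - j) = j.+1)%N by lia.
  have -> : (l - (l - j) = j)%N by lia.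
  by rewrite psum_recr natrD addrC addKr natrM.
rewrite sum_by_parts //; apply: eq_bigr => j _.
by rewrite natrM mulrC /X [psums v j]ffunE.
Qed.

Definition conj_term l := biexp (@Xdiff l) (@Ysum l).

(** The X half of the exponent is rewritten by summation by parts, the Y half by exchanging sums;
    the power of q is unchanged since conjugation preserves the weight. *)
Lemma conj_termE l (w : {ffun 'I_l -> nat} * {ffun 'I_l -> nat}) :
  adm w -> conj_term w = Tterm (conjugate w).
Proof.
move=> aw; rewrite /conj_term /Tterm /biexp conjugate_weight //; congr xexp.
case: w aw => u v /andP[/= pu _].
rewrite !big_split /= sum_Ysum addrC; congr (_ + _).
rewrite (sum_by_parts (X := Xlin l)) ?Xlin_l //.
by apply: eq_bigr => j _; rewrite Xlin_ord.
Qed.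

Lemma Tgen_conj_boxes l D E (m : 'X_{1..1 + l + l}) :
  (m (qv l) <= D)%N -> (m (qv l) <= E)%N ->
  Tgen m = \sum_(w <- boxes l D E | adm w) conj_term w m.
Proof.
move=> lD lE; rewrite (Tgen_boxesW lD lE); apply/esym.
rewrite (eq_bigr (fun w => Tterm (conjugate w) m)); last first.
  by move=> w aw; rewrite conj_termE.
apply: (sum_reindex (F := fun w => Tterm w m)); rewrite ?boxes_uniq //.
- exact: conjugate_adm.
- exact: conjugateK.
- by move=> w aw /Tterm_weight e; apply: adm_boxes e.
- move=> w aw /Tterm_weight; rewrite -conjugate_weight // => e.
  exact: adm_boxes e.
Qed.

(** * Both expansions and the partition relation *)

Lemma leq_mdeg_qv l (m : 'X_{1..1 + l + l}) : (m (qv l) <= mdeg m)%N.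
Proof. by rewrite mdegE (bigD1 (qv l)) //= leq_addr. Qed.

Lemma hasSum_biexp l (e f : 'I_l -> {mpoly rat[1 + l + l]}) :
  (forall j, e j \is 1.-homog) -> (forall j, f j \is 1.-homog) ->
  (forall w m, adm w -> biexp e f w m != 0 ->
     (\sum_j w.1 j * w.2 j)%N = m (qv l)) ->
  (forall m, Tgen m = \sum_(w <- boxes l (m (qv l)) (mdeg m) | adm w)
                        biexp e f w m) ->
  fps_hasSum (fun u : {ffun 'I_l -> nat} => pos_dec u)
    (fun u => fps_prod (fun j => fps_mul (Esub (u j) (e j)) (Lsub (u j) (f j))))
    (@Tgen l).
Proof.
move=> he hf wt Teq m.
have pE (u : {ffun 'I_l -> nat}) : pos_dec u ->
    fps_prod (fun j => fps_mul (Esub (u j) (e j)) (Lsub (u j) (f j))) m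
      = \sum_(v <- box l (mdeg m) | all_pos v) biexp e f (u, v) m.
  move=> pu; rewrite (@EL_prod _ _ _ _ (mdeg m)) //; last first.
    by apply/forallP/pos_dec_pos.
  rewrite big_box; apply: eq_big => [v|v _].
    by apply: eq_forallb => j; rewrite ffunE.
  rewrite /biexp /=; congr (xexp (qmon l _) _ m);
    by apply: eq_bigr => j _; rewrite ffunE.
(* Only [u] bounded by the exponent of q can contribute. The bound [mdeg m] on [v] is the truncation
   degree of [EL_prod]. *)
exists [seq u : {ffun 'I_l -> nat} <- box l (m (qv l)) | pos_dec u]; split.
- by rewrite filter_uniq // box_uniq.
- exact: filter_all.
- move=> u pu; rewrite pE // mem_filter pu /= => nz.
  (* A nonzero summand contains a nonzero term for some [v]; the weight of (u, v) is then the
     exponent of q, which bounds [u]. *)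
  have [v /andP[v0 nv]] : exists v : {ffun 'I_l -> nat},
      all_pos v && (biexp e f (u, v) m != 0).
    have [/hasP[v _ h]|/hasPn h] := boolP (has (fun v : {ffun 'I_l -> nat} =>
      all_pos v && (biexp e f (u, v) m != 0)) (box l (mdeg m))).
      by exists v.
    rewrite big_seq_cond big1 ?eqxx // in nz => v /andP[/h + v0].
    by rewrite v0 /= negbK => /eqP.
  have aw : adm (u, v) by rewrite /adm pu v0.
  have := adm_boxes (leqnn _) (leqnn _) aw (wt _ _ aw nv).
  by case/allpairsP=> -[u' v'] /= [? _ [-> _]].
- rewrite big_filter Teq big_boxes; apply: eq_bigr => u pu.
  by rewrite pE.
Qed.

Lemma dhomog_Xlin l k : Xlin l k \is 1.-homog.
Proof. by rewrite /Xlin; case: insub => [j|]; [apply: dhomog_var | apply: rpred0]. Qed.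

Lemma dhomog_Xdiff l (j : 'I_l) : Xdiff j \is 1.-homog.
Proof. by apply: rpredB; apply: dhomog_Xlin. Qed.

Lemma dhomog_Ysum l (j : 'I_l) : Ysum j \is 1.-homog.
Proof. by apply: rpred_sum => i _; apply: dhomog_var. Qed.

(** The substitution fixes q and sends the forms X_j, Y_j of [Tterm] to the forms [Ysum j],
    [Xdiff j] of [conj_term]. *)
Lemma partition_subst_Tterm l (w : {ffun 'I_l -> nat} * {ffun 'I_l -> nat}) :
  fps_subst (@partition_map l) (Tterm w) = conj_term w.
Proof.
have pq : partition_map (qv l) = 'X_(qv l).
  by rewrite /partition_map /qv (unsplitK (inl _)) (unsplitK (inl _)).
have px (j : 'I_l) : partition_map (xv j) = Ysum j.
  by rewrite /partition_map /xv (unsplitK (inl _)) (unsplitK (inr _)).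
have py (j : 'I_l) : partition_map (yv j) = Xdiff j.
  by rewrite /partition_map /yv (unsplitK (inr _)).
rewrite /Tterm /biexp fps_subst_qmon //; last first.
  by apply: rpred_sum => j _; rewrite linformD ?linformZ ?dhomog_var.
rewrite (big_morph _ (comp_mpolyD _) (comp_mpoly0 _)); congr xexp.
by apply: eq_bigr => j _; rewrite comp_mpolyD !comp_mpolyZ !comp_mpoly_var px py.
Qed.

Theorem theorem2p3 (l : nat) (hl : (0 < l)%N) :
  [/\ fps_hasSum (fun u : {ffun 'I_l -> nat} => pos_dec u) (@summand1 l) (@Tgen l),
      fps_hasSum (fun u : {ffun 'I_l -> nat} => pos_dec u) (@summand2 l) (@Tgen l)
    & @Tgen l = fps_subst (@partition_map l) (@Tgen l)].
Proof.
split.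
- apply: hasSum_biexp => [j|j|w m _|m]; rewrite ?dhomog_var //.
    exact: Tterm_weight.
  exact/Tgen_boxesW/leq_mdeg_qv.
- apply: hasSum_biexp => [j|j|w m aw|m].
  + exact: dhomog_Xdiff.
  + exact: dhomog_Ysum.
  + rewrite -/(@conj_term l) conj_termE // conjugate_weight //.
    exact: Tterm_weight.
  + exact/Tgen_conj_boxes/leq_mdeg_qv.
- apply: functional_extensionality => m.
  (* Substituting linear forms preserves degree, so the coefficient at [m] sees only this finite
     truncation, which can be substituted term by term. *)
  pose F := \big[@fps_add _/@fps_zero _]_(w <- boxes l (mdeg m) (mdeg m) | adm w)
              Tterm w.
  have TF : eq_upto (mdeg m) (@Tgen l) F.
    move=> m' le; rewrite /F fps_sumE; have := leq_trans (leq_mdeg_qv m') le.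
    by move=> h; apply: Tgen_boxesW.
  rewrite (fps_subst_upto _ TF) // fps_subst_sum.
  rewrite (@Tgen_conj_boxes l (mdeg m) (mdeg m)) ?leq_mdeg_qv //.
  by apply: eq_bigr => w _; rewrite partition_subst_Tterm.
Qed.
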